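(* Let $\mathcal{P}$ be a vine. The following are equivalent: (1) $\mathcal{P}$ is an m-vine, i.e. there exists an R-vine $\mathcal{R}$ such that $\mathcal{P}$ is an ideal (downward-closed subset) of $\mathcal{R}$; (2) $\mathcal{P}$ satisfies the proximity condition: for any distinct elements $a,b$ of the same rank $i\ge2$, if $a$ and $b$ are covered by a common element, then $a$ and $b$ cover a common element; (3) $\mathcal{P}$ is an LR-vine.
   Context: Posets are finite. A poset $\mathcal{P}$ is graded with rank function $\operatorname{rk}\colon\mathcal{P}\to\mathbb{Z}_{>0}$ if $x<y$ implies $\operatorname{rk}(x)<\operatorname{rk}(y)$, $\operatorname{rk}(y)=\operatorname{rk}(x)+1$ whenever $y$ covers $x$, and all minimal elements have rank $1$. $\mathcal{P}_i$ denotes the set of elements of rank $i$, $\operatorname{rk}(\mathcal{P})$ the maximal rank, $\dim(\mathcal{P})$ the number of minimal elements, and $\mathcal{E}(v)$ the set of elements covered by $v$. A vine is a finite graded poset such that (1) every non-minimal element covers exactly two elements, and any two distinct elements of the same rank are covered by at most one common element; (2) for each $1\le i\le\operatorname{rk}(\mathcal{P})$ the graph $F_i$ with vertex set $\mathcal{P}_i$ and edge set $\{\mathcal{E}(v)\mid v\in\mathcal{P}_{i+1}\}$ is a forest. An R-vine is a vine with $\operatorname{rk}(\mathcal{P})=\dim(\mathcal{P})$, every $F_i$ a tree, and satisfying the proximity condition. An LR-vine is a vine such that every principal ideal $\mathcal{P}_{\le v}=\{x\in\mathcal{P}\mid x\le v\}$, with the induced order and rank, is an R-vine. An ideal of a vine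 is regarded with the induced order and rank function. *)

(* Defs.v *)
From HB Require Import structures.
From mathcomp Require Import all_boot all_order.

Set Implicit Arguments.
Unset Strict Implicit.
Unset Printing Implicit Defensive.

Import Order.TTheory.
Local Open Scope order_scope.

Section Graphs.
Variable T : finType.

(* The graph with vertex set [V] and edge set [E], edges being 2-element sets
   of vertices, is represented by its adjacency relation. *)
Definition adj (V : {set T}) (E : {set {set T}}) : rel T :=
  fun x y => [&& x \in V, y \in V, x != y & [set x; y] \in E].

(* Bound 2 because an edge, traversed back and forth, is a [ucycle] of size 2;
   [adj] has no loops, so there is none of size 1. *)
Definition forest (V : {set T}) (E : {set {set T}}) : Prop :=
  forall s : seq T, ucycle (adj V E) s -> (size s <= 2)%N.

Definition connected (V : {set T}) (E : {set {set T}}) : Prop :=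
  V != set0 /\ {in V &, forall x y, connect (adj V E) x y}.

Definition tree (V : {set T}) (E : {set {set T}}) : Prop :=
  connected V E /\ forest V E.

End Graphs.

Section Posets.
Variables (d : Order.disp_t) (P : finPOrderType d).

Definition covers (y x : P) : bool := (x < y) && [forall z, ~~ (x < z < y)].

Definition minimal (x : P) : bool := [forall y, ~~ (y < x)].

Definition covered_by (v : P) : {set P} := [set x | covers v x].

(* The rank function is determined by the order, but is carried explicitly. *)
Definition graded (rk : P -> nat) : Prop :=
  [/\ forall x, (0 < rk x)%N,
      forall x y, x < y -> (rk x < rk y)%N,
      forall x y, covers y x -> rk y = (rk x).+1
    & forall x, minimal x -> rk x = 1%N].

Definition level (rk : P -> nat) (i : nat) : {set P} := [set x | rk x == i].

Definition poset_rank (rk : P -> nat) : nat := (\max_(x : P) rk x)%N.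

Definition poset_dim : nat := #|[set x : P | minimal x]|.

Definition level_edges (rk : P -> nat) (i : nat) : {set {set P}} :=
  [set covered_by v | v in level rk i.+1].

Definition vine (rk : P -> nat) : Prop :=
  [/\ graded rk,
      forall v, ~~ minimal v -> #|covered_by v| = 2,
      forall a b u v, a != b -> rk a = rk b ->
        covers u a -> covers u b -> covers v a -> covers v b -> u = v
    & forall i, (1 <= i <= poset_rank rk)%N ->
        forest (level rk i) (level_edges rk i)].

Definition proximity (rk : P -> nat) : Prop :=
  forall (i : nat) (a b : P), (2 <= i)%N -> rk a = i -> rk b = i -> a != b ->
    (exists v, covers v a /\ covers v b) ->
    exists c, covers a c /\ covers b c.

Definition R_vine (rk : P -> nat) : Prop :=
  [/\ vine rk,
      poset_rank rk = poset_dim,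
      forall i, (1 <= i <= poset_rank rk)%N ->
        tree (level rk i) (level_edges rk i)
    & proximity rk].

Definition principal_ideal (v : P) : Type := {x : P | x <= v}.

HB.instance Definition _ (v : P) := Finite.on (principal_ideal v).
HB.instance Definition _ (v : P) := SubChoice.on (principal_ideal v).
HB.instance Definition _ (v : P) :=
  [SubChoice_isSubPOrder of principal_ideal v by <: with d].

End Posets.

Definition LR_vine (d : Order.disp_t) (P : finPOrderType d) (rk : P -> nat) :
    Prop :=
  vine rk /\
  forall v : P, R_vine (fun x : principal_ideal v => rk (val x)).

(* [P] is identified with an ideal of [R] along the order embedding [f]. *)
Definition m_vine (d : Order.disp_t) (P : finPOrderType d) (rk : P -> nat) :
    Prop :=
  exists (d' : Order.disp_t) (R : finPOrderType d') (rkR : R -> nat)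
         (f : P -> R),
    [/\ R_vine rkR,
        {mono f : x y / x <= y},
        forall (x : P) (y : R), y <= f x -> exists z : P, y = f z
      & forall x : P, rkR (f x) = rk x].

(* Main.v *)
(* (1) => (2) and (3) => (2): covers in an ideal are covers in the ambient
   poset, and the common lower covers asked for lie in the ideal.

   (2) => (3): if v covers a and b, the levels of the ideals below a and b are
   connected by induction, and they meet below the common lower cover of a and
   b; so every level graph of the ideal below v is a tree.  A tree has one
   vertex more than it has edges and the edges of F_i are the elements of rank
   i + 1, so the levels have sizes r, r - 1, ..., 1, whence rank = dimension.

   (2) => (1): if some F_i is disconnected, take i minimal.  Then some a and b
   of rank i in different components of F_i share a lower cover (or i = 1), and
   adding an element above a and b gives a larger vine with proximity and the
   same minimal elements.  Forests have fewer edges than vertices, so the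
   dimension bounds the size of a vine; hence the process stops, at an
   R-vine. *)
From HB Require Import structures.
Require Import Defs.
From mathcomp Require Import all_boot all_order zify.

Set Implicit Arguments.
Unset Strict Implicit.
Unset Printing Implicit Defensive.

Import Order.TTheory.
Local Open Scope order_scope.

(** * Cycles and components of graphs *)
Section Graphs.
Variable T : finType.
Implicit Types (e : rel T) (V : {set T}) (E : {set {set T}}) (x y a b : T).

(** [forest V E] unfolds to [acyclic (adj V E)]; a bare relation makes it easy to add or drop an
    edge. *)
Definition acyclic e := forall s, ucycle e s -> (size s <= 2)%N.

Definition add_edge e a b : rel T :=
  fun x y => [|| e x y, (x == a) && (y == b) | (x == b) && (y == a)].

Lemma set2_eq x y a b :
  ([set x; y] == [set a; b]) = (x == a) && (y == b) || (x == b) && (y == a).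
Proof.
apply/eqP/idP => [/setP E|/orP[] /andP[/eqP-> /eqP->] //]; last by rewrite setUC.
move: (E x) (E y) (E a) (E b).
rewrite !inE !eqxx (eq_sym a x) (eq_sym a y) (eq_sym b x) (eq_sym b y).
rewrite !orbT /=.
by case: (x == a); case: (x == b); case: (y == a); case: (y == b).
Qed.

(** The rest of the cycle leads from [next s x] back to [x]. With at least three distinct vertices,
    no other edge of the cycle has the same two ends. *)
Lemma ucycle_bridge e e' s x : ucycle e s -> (2 < size s)%N -> x \in s ->
    (forall u w, e u w -> [set u; w] != [set x; next s x] -> e' u w) ->
  connect e' (next s x) x.
Proof.
case/andP=> cs us + xs; have [i s' rs] := rot_to xs.
rewrite -(next_rot i) // -(size_rot i); move: cs us.
rewrite -(rot_cycle i) -(rot_uniq i) rs.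
case: s' {rs} => [|y [|z t]] //= /and3P[exy eyz pt] + _; rewrite eqxx.
rewrite !inE !negb_or -!andbA => /and5P[xy xz xt yz /and3P[yt _ _]] He.
apply/connectP; exists (z :: rcons t x); last by rewrite /= last_rcons.
have out u : u != x -> u != y -> forall w, [set u; w] != [set x; y].
  move=> ux uy w; apply/eqP => /setP/(_ u).
  by rewrite !inE eqxx (negbTE ux) (negbTE uy).
rewrite /= He //=; last by rewrite setUC out // eq_sym.
(* From [z] on the path never meets [y], so none of its edges is the excluded one. *)
apply/(sub_in_path (P := predC1 y) (e := e)): pt; last first.
  rewrite /= eq_sym yz all_rcons /= xy; apply/allP => u ut /=.
  by apply: contraNneq yt => <-.
move=> u w /= uy wy euw; apply: He => //.
apply/eqP => /setP/(_ y); rewrite !inE eqxx orbT.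
by rewrite eq_sym (negbTE uy) eq_sym (negbTE wy).
Qed.

(** In a cycle of length above 2 through the new edge, the remaining edges would be old and would
    connect [a] and [b]; so such a cycle has old edges only. *)
Lemma acyclic_add_edge e a b :
  symmetric e -> acyclic e -> ~~ connect e a b -> acyclic (add_edge e a b).
Proof.
move=> esym eacyc nab s cs; rewrite leqNgt; apply/negP => s3.
have/andP[cs1 us] := cs.
suff: (size s <= 2)%N by rewrite leqNgt s3.
apply: eacyc; rewrite /ucycle us andbT; apply: cycle_from_next => // x xs.
have cyx e' := @ucycle_bridge _ e' s x cs s3 xs.
have csym := sym_connect_sym esym.
have /or3P[//| |] := next_cycle cs1 xs => /andP[/eqP xa /eqP yb];
  case/negP: nab; [rewrite csym|]; rewrite -{1}yb -{1}xa; apply: cyx => u w;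
  case/or3P => // /andP[/eqP-> /eqP->];
  by rewrite yb xa ?[[set b; a]]setUC eqxx.
Qed.

(** A shortened [e']-path from [a] to [b], closed by the edge of [e], is a cycle. Having at most two
    vertices, it is the edge itself, which [e'] lacks. *)
Lemma acyclic_bridge e e' a b : symmetric e -> acyclic e -> e a b -> a != b ->
    subrel e' e -> ~~ e' a b -> ~~ connect e' a b.
Proof.
move=> esym eacyc eab ab sub nab; apply/connectP => -[p pp bE].
move: nab ab eab; rewrite bE; case/shortenP: pp => q pq uq _ nab ab eab.
have := eacyc (a :: q).
rewrite /ucycle uq /= rcons_path (sub_path sub pq) esym eab => /(_ isT).
by case: q nab ab pq {uq eab} => [|c [|]] //=; rewrite ?eqxx // => /negbTE->.
Qed.

Lemma adj_sym V E : symmetric (adj V E).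
Proof. by move=> x y; rewrite /adj setUC eq_sym andbCA. Qed.

Lemma connect_ind e (Q : T -> Prop) x y :
  (forall u w, e u w -> Q u -> Q w) -> connect e x y -> Q x -> Q y.
Proof.
move=> step /connectP[p + ->].
elim: p x => //= z p IHp x /andP[exz pz] Qx.
by apply: IHp pz _; apply: step Qx.
Qed.

(* [r] maps a vertex to a representative of its component, so [r @: V] counts
   the components. *)
Lemma forest_components V E :
    {in E, forall s, exists a b, [/\ a \in V, b \in V, a != b & s = [set a; b]]} ->
  exists r : T -> T,
    (forall x y, connect (adj V E) x y = (r x == r y)) /\
    (forest V E -> #|V| = (#|r @: V| + #|E|)%N).
Proof.
have [n] := ubnP #|E|; elim: n E => // n IHn E ltEn edgeE.
have [->|[s sE]] := set_0Vmem E.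
  exists id; rewrite imset_id cards0 addn0; split=> // x y.
  apply/idP/eqP => [|->]; last exact: connect0.
  by move/connect_ind; apply=> // u w; rewrite /adj inE !andbF.
have [a [b [aV bV nab sab]]] := edgeE s sE.
have cardE := cardsD1 s E; rewrite sE add1n in cardE.
have [r [rE eq_r]] : exists r : T -> T,
    (forall x y, connect (adj V (E :\ s)) x y = (r x == r y)) /\
    (forest V (E :\ s) -> #|V| = (#|r @: V| + #|E :\ s|)%N).
  by apply: IHn => [|t /setD1P[_ /edgeE]] //; rewrite -ltnS -cardE.
have adjE : adj V E =2 add_edge (adj V (E :\ s)) a b.
  move=> x y; rewrite /add_edge /adj in_setD1 -set2_eq -sab.
  case: (eqVneq [set x; y] s) => [sxy|nxy] /=; last by rewrite orbF.
  rewrite !andbF sxy sE andbT /=; move/eqP: sxy; rewrite sab set2_eq.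
  by case/orP=> /andP[/eqP-> /eqP->]; rewrite aV bV // eq_sym nab.
(* Putting the edge [s] back merges the component of [b] into that of [a]. *)
pose g x := if r x == r b then r a else r x.
have gab : g a = g b by rewrite /g eqxx; case: eqP.
have gE x y : connect (adj V E) x y = (g x == g y).
  rewrite (eq_connect adjE); apply/idP/eqP => [|].
    move/(@connect_ind _ (fun y => g x = g y)); apply=> // u w + ->.
    case/or3P => [/connect1||/andP[/eqP-> /eqP->] //]; last first.
      by case/andP=> /eqP-> /eqP->.
    by rewrite /g rE => /eqP->.
  have sub u w : r u = r w -> connect (add_edge (adj V (E :\ s)) a b) u w.
    move/eqP; rewrite -rE; apply: connect_sub => {}u {}w uw.
    by apply: connect1; rewrite /add_edge uw.
  have cab : connect (add_edge (adj V (E :\ s)) a b) a b.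
    by apply: connect1; rewrite /add_edge !eqxx orbT.
  have cba : connect (add_edge (adj V (E :\ s)) a b) b a.
    by apply: connect1; rewrite /add_edge !eqxx !orbT.
  rewrite /g; case: eqP => [xb|_]; case: eqP => [yb|_].
  - by move=> _; apply: sub; rewrite xb.
  - by move/sub; apply: connect_trans; apply: connect_trans (sub _ _ xb) cba.
  - by move/sub/connect_trans; apply; apply: connect_trans cab (sub _ _ _).
  - exact: sub.
(* If [a] and [b] are connected without [s], then [s] closes a cycle, against the forest
   hypothesis. *)
have [eab|neab] := eqVneq (r a) (r b).
  exists g; split=> // F; exfalso; move: (rE a b); rewrite eab eqxx; apply/negP.
  apply: acyclic_bridge F _ nab _ _; first exact: adj_sym.
  - by rewrite adjE /add_edge !eqxx orbT.
  - by move=> u w; rewrite adjE /add_edge => ->.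
  - by rewrite /adj -sab !inE eqxx !andbF.
(* Otherwise exactly one representative is lost for the one edge gained. *)
have gr : g @: V = (r @: V) :\ r b.
  apply/setP => z; rewrite in_setD1; apply/imsetP/andP => [[x xV ->]|[zb]].
    rewrite /g; case: (eqVneq (r x) (r b)) => [_|xb]; last by rewrite xb imset_f.
    by rewrite neab imset_f.
  by case/imsetP=> x xV zx; exists x; rewrite // /g -zx (negbTE zb).
have cr := cardsD1 (r b) (r @: V); rewrite imset_f // -gr in cr.
exists g; split=> // F.
have: forest V (E :\ s).
  move=> c /andP[cc uc]; apply: F; rewrite /ucycle uc andbT.
  by apply: sub_cycle cc => u w; rewrite adjE /add_edge => ->.
by move/eq_r; lia.
Qed.

(** A nonempty vertex set has at least one component. *)
Lemma forest_card V E : V != set0 ->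
    {in E, forall s, exists a b, [/\ a \in V, b \in V, a != b & s = [set a; b]]} ->
  forest V E -> (#|E| < #|V|)%N.
Proof.
move=> /set0Pn[x xV] /forest_components[r [_ cV]] /cV ->.
by rewrite -add1n leq_add2r card_gt0; apply/set0Pn; exists (r x); apply: imset_f.
Qed.

(** Connectedness leaves a single representative. *)
Lemma tree_card V E :
    {in E, forall s, exists a b, [/\ a \in V, b \in V, a != b & s = [set a; b]]} ->
  tree V E -> #|V| = #|E|.+1.
Proof.
move=> edgeE [[/set0Pn[x xV] cVE] fVE].
have [r [rE /(_ fVE) ->]] := forest_components edgeE.
rewrite (_ : r @: V = [set r x]) ?cards1 //.
apply/eqP; rewrite eqEsubset sub1set imset_f // andbT.
by apply/subsetP => _ /imsetP[y yV ->]; rewrite inE -rE cVE.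
Qed.
End Graphs.

(** * Graded posets and vines *)
Section Graded.
Variables (d : Order.disp_t) (P : finPOrderType d) (rk : P -> nat).
Hypothesis grP : graded rk.
Implicit Types (x y z u v : P).

Lemma covers_lt y x : covers y x -> x < y.
Proof. by case/andP. Qed.

Lemma graded_lt x y : x < y -> (rk x < rk y)%N.
Proof. by case: grP => _ + _ _; apply. Qed.

Lemma graded_covers x y : covers y x -> rk y = (rk x).+1.
Proof. by case: grP => _ _ + _; apply. Qed.

Lemma graded_inj x y : x <= y -> rk x = rk y -> x = y.
Proof. by rewrite le_eqVlt => /predU1P[//|/graded_lt]; lia. Qed.

Lemma minimalE x : minimal x = (rk x == 1%N).
Proof.
apply/idP/eqP => [|rx]; first by case: grP => _ _ _; apply.
by apply/forallP => y; apply/negP => /graded_lt; case: grP => /(_ y); lia.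
Qed.

(** An element of maximal rank among the [z] with [x <= z < v] is covered by [v]. *)
Lemma lt_covers x v : x < v -> exists2 u, covers v u & x <= u.
Proof.
move=> xv; have Px : (x <= x < v) by rewrite lexx.
case: (@arg_maxnP _ x (fun z => x <= z < v) rk Px) => u /andP[xu uv] maxu.
exists u => //; rewrite /covers uv; apply/forallP => z.
apply/negP => /andP[uz zv].
have := maxu z; rewrite (le_trans xu (ltW uz)) zv => /(_ isT).
by have := graded_lt uz; rewrite /=; lia.
Qed.

Lemma nonminimal_covers v : (1 < rk v)%N -> exists u, covers v u.
Proof.
move=> rv; have : ~~ minimal v by rewrite minimalE; lia.
rewrite negb_forall => /existsP[x]; rewrite negbK => /lt_covers[u vu _].
by exists u.
Qed.

Lemma exists_below v i : (1 <= i <= rk v)%N -> exists2 x, x <= v & rk x = i.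
Proof.
have [n] := ubnP (rk v); elim: n v => // n IHn v vn iv.
have [->|niv] := eqVneq i (rk v); first by exists v.
have [|u vu] := @nonminimal_covers v; first by lia.
have rv := graded_covers vu.
have [||x xu rx] := IHn u; [lia|lia|].
by exists x => //; apply: le_trans xu (ltW (covers_lt vu)).
Qed.

Lemma rank_ge x : (rk x <= poset_rank rk)%N.
Proof. exact: leq_bigmax. Qed.

Lemma level_neq0 i : (1 <= i <= poset_rank rk)%N -> level rk i != set0.
Proof.
case/andP=> i1 ir; apply/set0Pn.
have [v iv] : exists v, (i <= rk v)%N.
  apply/existsP; apply: contraTT ir; rewrite negb_exists => /forallP H.
  rewrite -ltnNge -(prednK i1) ltnS; apply/bigmax_leqP => v _.
  by move: (H v); lia.
have [|x _ rx] := @exists_below v i; first by lia.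
by exists x; rewrite inE rx.
Qed.

Lemma level_rank_gt i : (poset_rank rk < i)%N -> level rk i = set0.
Proof.
move=> ri; apply/setP => x; rewrite !inE; apply/negbTE.
by have := rank_ge x; lia.
Qed.

Lemma dimE : poset_dim P = #|level rk 1|.
Proof. by apply: eq_card => x; rewrite !inE minimalE. Qed.

Hypothesis card2 : forall v, ~~ minimal v -> #|covered_by v| = 2.

Lemma covered_by2 u x y : covers u x -> covers u y -> x != y ->
  covered_by u = [set x; y].
Proof.
move=> ux uy xy; apply/esym/eqP; rewrite eqEcard cards2 xy card2.
  by rewrite subUset !sub1set !inE ux uy.
by rewrite minimalE (graded_covers ux); case: grP => /(_ x); lia.
Qed.

(** Two distinct lower covers of [u] exhaust [covered_by u], so an edge amounts to a common upper
    cover; the rank of [y] then follows from that of [x]. *)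
Lemma adjE i x y : adj (level rk i) (level_edges rk i) x y =
  [&& rk x == i, x != y & [exists u, covers u x && covers u y]].
Proof.
rewrite /adj !inE; apply/and4P/and3P => [[rx _ xy /imsetP[v _ Ev]]|].
  split=> //; apply/existsP; exists v.
  by move: (set21 x y) (set22 x y); rewrite Ev !inE => -> ->.
case=> /eqP rx xy /existsP[u /andP[ux uy]].
have := graded_covers ux; have := graded_covers uy => ru ru'.
split=> //; [by rewrite rx|apply/eqP; lia|].
apply/imsetP; exists u; last by rewrite (covered_by2 ux uy).
by rewrite inE ru' rx.
Qed.
End Graded.

(** * Level sizes of a vine *)

Section Vine.
Variables (d : Order.disp_t) (P : finPOrderType d) (rk : P -> nat).
Hypothesis vP : vine rk.
Implicit Types (x y z u v a b : P).

Let grP : graded rk. Proof. by case: vP. Qed.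

Lemma vine_adjE i x y : adj (level rk i) (level_edges rk i) x y =
  [&& rk x == i, x != y & [exists u, covers u x && covers u y]].
Proof. by apply: adjE => //; case: vP. Qed.

(** Frees [i] from its range: a vertex of a nonempty cycle has rank [i], which puts [i] in the
    range. *)
Lemma vine_forest i : forest (level rk i) (level_edges rk i).
Proof.
have [ir|ir] := boolP (1 <= i <= poset_rank rk)%N.
  by case: vP => _ _ _; apply.
move=> [|x s] //= /andP[] cs _; exfalso; move/negP: ir; apply.
have : adj (level rk i) (level_edges rk i) x (head x (rcons s x)).
  by case: (s) cs => [|y t] /= /andP[].
rewrite vine_adjE => /and3P[/eqP<- _ _]; rewrite rank_ge andbT.
by case: grP.
Qed.

Lemma vine_covered v : (1 < rk v)%N ->
  exists a b, [/\ a != b, covers v a, covers v b & covered_by v = [set a; b]].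
Proof.
move=> rv; have : #|covered_by v| = 2.
  by case: vP => _ + _ _; apply; rewrite (minimalE grP); lia.
move/eqP/cards2P => [a [b [ab Ev]]]; exists a, b; split=> //.
  by move: (set21 a b); rewrite -Ev inE.
by move: (set22 a b); rewrite -Ev inE.
Qed.

Lemma level_edgesP i : (0 < i)%N -> {in level_edges rk i, forall s,
  exists a b, [/\ a \in level rk i, b \in level rk i, a != b & s = [set a; b]]}.
Proof.
move=> i0 _ /imsetP[v + ->]; rewrite inE => /eqP rv.
have [|a [b [ab va vb Ev]]] := @vine_covered v; first by lia.
exists a, b; rewrite !inE Ev; split=> //.
  by have := graded_covers grP va; lia.
by have := graded_covers grP vb; lia.
Qed.

(** An element of rank [i.+1] is determined by the pair it covers, by uniqueness of common upper
    covers. *)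
Lemma card_level_edges i : (0 < i)%N -> #|level_edges rk i| = #|level rk i.+1|.
Proof.
move=> i0; apply: card_in_imset => u v; rewrite !inE => /eqP ru /eqP rv Euv.
have [|a [b [ab va vb _]]] := @vine_covered v; first by lia.
have /andP[ua ub] : covers u a && covers u b.
  by move/setP: Euv => Euv; move: (Euv a) (Euv b); rewrite !inE va vb => -> ->.
case: vP => _ _ + _; apply; [exact: ab| |exact: ua|exact: ub|exact: va|exact: vb].
by have := graded_covers grP va; have := graded_covers grP vb; lia.
Qed.

(** A nonempty forest has fewer edges than vertices, so each level is smaller than the one below it;
    above an empty level all is empty, which suits the truncated subtraction. *)
Lemma card_level_le i : (#|level rk i.+1| <= poset_dim P - i)%N.
Proof.
elim: i => [|i IHi]; first by rewrite (dimE grP) subn0.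
have [E|N] := eqVneq (level rk i.+1) set0.
  rewrite -card_level_edges // /level_edges.
  have [->|/set0Pn[v]] := eqVneq (level rk i.+2) set0; first by rewrite imset0 cards0.
  rewrite inE => /eqP rv; have [|u vu] := @nonminimal_covers _ _ _ grP v; first by lia.
  have : u \in level rk i.+1 by rewrite inE; have := graded_covers grP vu; lia.
  by rewrite E inE.
have := forest_card N (level_edgesP (ltn0Sn i)) (@vine_forest i.+1).
by rewrite card_level_edges //; lia.
Qed.

(** A crude bound in terms of the dimension alone, which makes the repeated adding of elements
    terminate. *)
Lemma card_vine_le : (#|P| <= (poset_dim P).+1 ^ 2)%N.
Proof.
pose n := poset_dim P.
have rkn x : (rk x < n.+1)%N.
  have := card_level_le (rk x).-1; rewrite prednK; last by case: grP.
  rewrite -/n => le; have : (0 < #|level rk (rk x)|)%N.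
    by rewrite card_gt0; apply/set0Pn; exists x; rewrite inE.
  by case: grP => /(_ x); lia.
(* The elements are sorted by rank from 0 to [n]; the class of rank 0 is empty. *)
rewrite -sum1_card (partition_big (fun x => inord (rk x) : 'I_n.+1) xpredT) //=.
apply: leq_trans (_ : \sum_(i < n.+1) n.+1 <= _)%N; last first.
  by rewrite sum_nat_const card_ord mulnn.
apply: leq_sum => i _; rewrite sum1_card.
apply: leq_trans (_ : #|level rk i| <= _)%N.
  apply: subset_leq_card; apply/subsetP => x; rewrite !inE => /eqP <-.
  by apply/eqP; rewrite -[RHS]/(nat_of_ord _) inordK.
have [i0|i0] := posnP i.
  rewrite (_ : level rk i = set0) ?cards0 //; apply/setP => x; rewrite !inE i0.
  by apply/negbTE; case: grP => /(_ x); lia.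
by have := card_level_le i.-1; rewrite prednK // -/n; lia.
Qed.

Hypothesis conP : forall i, (1 <= i <= poset_rank rk)%N ->
  {in level rk i &, forall x y, connect (adj (level rk i) (level_edges rk i)) x y}.

Lemma connected_vine_rank : poset_rank rk = poset_dim P.
Proof.
pose r := poset_rank rk.
(* Levels are counted from the top: above rank [r] there is nothing, each step down gains one
   vertex, and [k = r] reaches the minimal elements. *)
suff H k : (k <= r)%N -> #|level rk (r - k).+1| = k.
  by rewrite (dimE grP) -[LHS](H r) // subnn.
elim: k => [_|k IHk kr]; first by rewrite subn0 level_rank_gt ?cards0.
have rk1 : (0 < r - k)%N by lia.
have -> : (r - k.+1).+1 = (r - k)%N by lia.
rewrite (tree_card (level_edgesP rk1)) ?card_level_edges ?IHk //; first by lia.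
split; last exact: vine_forest.
have rkr : (1 <= r - k <= poset_rank rk)%N by rewrite rk1 leq_subr.
by split; [apply: level_neq0|apply: conP].
Qed.

Lemma connected_R_vine : proximity rk -> R_vine rk.
Proof.
split=> //; first exact: connected_vine_rank.
move=> i ir; split; last exact: vine_forest.
by split; [apply: level_neq0|apply: conP].
Qed.
End Vine.

(** * Ideals, given by order embeddings with downward-closed image *)

Section Ideal.
Variables (d d' : Order.disp_t) (Q : finPOrderType d) (P : finPOrderType d').
Variables (rk : P -> nat) (rkQ : Q -> nat) (f : Q -> P).
Hypotheses (f_mono : {mono f : x y / x <= y})
  (f_ideal : forall (x : Q) (y : P), y <= f x -> exists z : Q, y = f z)
  (rk_f : forall x, rk (f x) = rkQ x).

(** Whatever lies strictly between [f x] and [f y] is below [f y], hence in the image. *)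
Lemma ideal_covers x y : covers (f y) (f x) = covers y x.
Proof.
rewrite /covers (leW_mono f_mono); congr (_ && _).
apply/forallP/forallP => H z; first by rewrite -!(leW_mono f_mono).
apply/negP => /andP[xz zy]; have [t zt] := f_ideal (ltW zy).
by move: (H t); rewrite -!(leW_mono f_mono) -zt xz zy.
Qed.

Lemma ideal_minimal x : minimal (f x) = minimal x.
Proof.
apply/forallP/forallP => H z; first by rewrite -(leW_mono f_mono).
apply/negP => zx; have [t zt] := f_ideal (ltW zx).
by move: (H t); rewrite -(leW_mono f_mono) -zt zx.
Qed.

Lemma ideal_covered v y : covers (f v) y -> exists x, y = f x.
Proof. by move/covers_lt/ltW/f_ideal. Qed.

Lemma ideal_vine : vine rk -> vine rkQ.
Proof.
move=> vP; have f_inj := inc_inj f_mono.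
case: (vP) => -[gr0 grlt grc grm] c2 cu _.
have grQ : graded rkQ.
  split=> [x|x y|y x|x]; rewrite -!rk_f //.
  - by rewrite -(leW_mono f_mono); apply: grlt.
  - by rewrite -ideal_covers; apply: grc.
  - by rewrite -ideal_minimal; apply: grm.
have c2Q (v : Q) : ~~ minimal v -> #|covered_by v| = 2.
  rewrite -ideal_minimal => /c2 <-; rewrite -(card_imset _ f_inj).
  apply: eq_card => y; rewrite inE; apply/imsetP/idP => [[x + ->]|vy].
    by rewrite inE ideal_covers.
  have [x yx] := ideal_covered vy.
  by exists x; rewrite // inE -ideal_covers -yx.
split=> // [a b u v ab rab ua ub va vb|i _ s /andP[cs us]].
  apply: (f_inj); apply: (cu (f a) (f b)); rewrite ?ideal_covers //.
    by rewrite (inj_eq f_inj).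
  by rewrite !rk_f.
(* [f] carries a cycle of a level graph of [Q] to a cycle of the same length in [P]. *)
rewrite -(size_map f); apply: (vine_forest vP (i := i)).
rewrite /ucycle map_inj_uniq // us andbT cycle_map.
apply: sub_cycle cs => x y; rewrite (adjE grQ) //= (vine_adjE vP) rk_f.
case/and3P=> -> xy /existsP[u uxy]; rewrite (inj_eq f_inj) xy.
by apply/existsP; exists (f u); rewrite !ideal_covers.
Qed.

Lemma ideal_proximity : proximity rk -> proximity rkQ.
Proof.
move=> pP i a b i2 ra rb ab [v [va vb]].
have [||||c [ac bc]] := pP i (f a) (f b) i2; rewrite ?rk_f //.
- by rewrite (inj_eq (inc_inj f_mono)).
- by exists (f v); rewrite !ideal_covers.
have [x cx] := ideal_covered ac.
by exists x; rewrite -!ideal_covers -cx.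
Qed.
End Ideal.

(** * Principal ideals *)
Section PrincipalIdeal.
Variables (d : Order.disp_t) (P : finPOrderType d) (rk : P -> nat).
Hypotheses (vP : vine rk) (pP : proximity rk).
Implicit Types (x y z u v : P).

Let grP : graded rk. Proof. by case: vP. Qed.

(** The union of all level graphs of the ideal below [v], kept on [P] to avoid the subtype. It also
    has loops, which do not affect connectivity. *)
Definition below v : rel P :=
  fun x y => [exists u, [&& u <= v, covers u x & covers u y]].

Lemma below_connect_le u v x y : u <= v ->
  connect (below u) x y -> connect (below v) x y.
Proof.
move=> uv; apply: connect_sub => {}x {}y /existsP[w /and3P[wu wx wy]].
by apply/connect1/existsP; exists w; rewrite (le_trans wu uv) wx.
Qed.

(** Induction on the rank of [v]: [x] and [y] lie below lower covers [a] and [b] of [v], and paths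
    in their ideals are joined at some [z] below both. *)
Lemma below_connect v x y : x <= v -> y <= v -> rk x = rk y ->
  connect (below v) x y.
Proof.
have [n] := ubnP (rk v); elim: n v x y => // n IHn v x y vn xv yv rxy.
move: (xv); rewrite le_eqVlt => /predU1P[xE|/(lt_covers grP)[a va xa]].
  by rewrite (graded_inj grP yv) // -xE ?connect0.
move: (yv); rewrite le_eqVlt => /predU1P[yE|/(lt_covers grP)[b vb yb]].
  by rewrite (graded_inj grP xv) // -yE ?connect0.
have ra := graded_covers grP va; have rb := graded_covers grP vb.
have rab : rk a = rk b by apply: succn_inj; rewrite -ra.
have ltan : (rk a < n)%N by rewrite -ltnS -ra.
have ltbn : (rk b < n)%N by rewrite -rab.
have av := ltW (covers_lt va); have bv := ltW (covers_lt vb).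
have [ab|ab] := eqVneq a b.
  by apply: (below_connect_le av); apply: IHn; rewrite ?[x <= a]xa // ab.
have [xE|xa'] := eqVneq x a.
  have yE : y = b by apply: (graded_inj grP) => //; rewrite -rxy xE.
  by apply/connect1/existsP; exists v; rewrite lexx xE yE va.
have xlta : x < a by rewrite lt_neqAle xa'.
have rxa := graded_lt grP xlta; have rx0 : (0 < rk x)%N by case: grP.
(* Here [a] has rank above that of [x], hence at least 2, so proximity applies. *)
have [c [ac bc]] : exists c, covers a c /\ covers b c.
  by apply: (pP (i := rk a)); [exact: leq_ltn_trans rxa| | | |exists v].
have rc := graded_covers grP ac.
have [|z zc rz] := @exists_below _ _ _ grP c (rk x); first by rewrite rx0 -ltnS -rc.
apply: (connect_trans (y := z)).
  apply: (below_connect_le av); apply: IHn => //.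
  exact: le_trans zc (ltW (covers_lt ac)).
apply: (below_connect_le bv); apply: IHn => //; last by rewrite rz.
exact: le_trans zc (ltW (covers_lt bc)).
Qed.

Lemma principal_ideal_mono v : {mono (val : principal_ideal v -> P) : x y / x <= y}.
Proof. by move=> x y; rewrite leEsub. Qed.

Lemma principal_ideal_closed v (x : principal_ideal v) y :
  y <= val x -> exists z : principal_ideal v, y = val z.
Proof. by move=> yx; exists (Sub y (le_trans yx (valP x))); rewrite SubK. Qed.

End PrincipalIdeal.
Arguments principal_ideal_mono {d P}.
Arguments principal_ideal_closed {d P v}.

Lemma proximity_LR_vine (d : Order.disp_t) (P : finPOrderType d) (rk : P -> nat) :
  vine rk -> proximity rk -> LR_vine rk.
Proof.
move=> vP pP; split=> // v.
pose rkv (x : principal_ideal v) := rk (val x).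
have vv : vine rkv.
  exact: ideal_vine (principal_ideal_mono v) principal_ideal_closed _ vP.
have pv : proximity rkv.
  exact: ideal_proximity (principal_ideal_mono v) principal_ideal_closed _ pP.
apply: connected_R_vine => // i _ x y; rewrite !inE => /eqP rx /eqP ry.
have grP : graded rk by case: vP.
have := below_connect vP pP (valP x) (valP y) (etrans rx (esym ry)).
(* The path in [P] is lifted to the ideal vertex by vertex; each step is witnessed by an element
   below [v]. *)
move/(@connect_ind _ _ (fun w => forall z : principal_ideal v, val z = w ->
  rk w = i -> connect (adj (level rkv i) (level_edges rkv i)) x z)).
apply=> // [u w /existsP[t /and3P[tv tu tw]] IHu z zw rw|z /val_inj->] //.
have ut := ltW (covers_lt tu); have uv := le_trans ut tv.
have ru : rk u = i by have := graded_covers grP tu; have := graded_covers grP tw; lia.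
have {IHu}cu := IHu (Sub u uv) erefl ru.
(* Loops of [below] are not edges of the level graph and are skipped. *)
have [zu|zu] := eqVneq (Sub u uv) z; first by rewrite -zu.
apply: connect_trans cu (connect1 _).
rewrite (vine_adjE vv) zu /rkv SubK ru eqxx /=.
apply/existsP; exists (Sub t tv).
rewrite -!(ideal_covers (principal_ideal_mono v) principal_ideal_closed) !SubK.
by rewrite zw tu.
Qed.

(** * Adding an element above two elements *)
Section AddElement.
Variables (d : Order.disp_t) (P : finPOrderType d).

(* [None] is the new element, covering exactly [a] and [b]. *)
Definition extension (a b : P) : Type := option P.

Section Order.
Variables a b : P.

Definition extension_le : rel (extension a b) := fun x y =>
  match x, y with
  | Some x, Some y => x <= y
  | Some x, None => (x <= a) || (x <= b)
  | None, Some _ => false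
  | None, None => true
  end.

Lemma extension_le_refl : reflexive extension_le.
Proof. by case=> [x|] /=. Qed.

Lemma extension_le_anti : antisymmetric extension_le.
Proof. by case=> [x|] [y|] //=; [move/le_anti ->|rewrite andbF]. Qed.

Lemma extension_le_trans : transitive extension_le.
Proof.
case=> [y|] [x|] [z|] //=; first exact: le_trans.
by move=> xy /orP[] yz; rewrite (le_trans xy yz) ?orbT.
Qed.

HB.instance Definition _ := Finite.on (extension a b).
HB.instance Definition _ := Order.Le_isPOrder.Build d (extension a b)
  extension_le_refl extension_le_anti extension_le_trans.
End Order.

Variables (rk : P -> nat) (a b : P).
Hypotheses (vP : vine rk) (rab : rk a = rk b).
Hypothesis nab : ~~ connect (adj (level rk (rk a)) (level_edges rk (rk a))) a b.

Let grP : graded rk. Proof. by case: vP. Qed.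

Let ab : a != b.
Proof. by apply: contraNneq nab => ->; apply: connect0. Qed.

Definition extension_rk (x : extension a b) : nat :=
  if x is Some y then rk y else (rk a).+1.

Definition extension_in (x : P) : extension a b := Some x.

Lemma extension_in_inj : injective extension_in.
Proof. by move=> x y []. Qed.

Lemma extension_in_mono : {mono extension_in : x y / x <= y}.
Proof. by []. Qed.

Lemma extension_in_closed (x : P) (y : extension a b) :
  y <= extension_in x -> exists z : P, y = extension_in z.
Proof. by case: y => [z|] // _; exists z. Qed.

Lemma extension_ltN x : (extension_in x < None :> extension a b) =
  (x <= a) || (x <= b).
Proof. by rewrite lt_neqAle. Qed.

(** Equal ranks exclude [a < b] and [b < a], so both are maximal below the new element. *)
Lemma extension_coversN x : covers (None : extension a b) (extension_in x) =
  (x == a) || (x == b).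
Proof.
apply/idP/idP => [/andP[]|].
  rewrite extension_ltN => xab /forallP H; apply: contraT; rewrite negb_or.
  case/andP=> xa xb.
  have := H (extension_in a); have := H (extension_in b); rewrite !extension_ltN.
  rewrite !(leW_mono extension_in_mono) !lt_neqAle xa xb !lexx orbT /= !andbT.
  by case/orP: xab => ->.
move=> xab; have rx : rk x = rk a by case/orP: xab => /eqP-> //.
apply/andP; split.
  by rewrite extension_ltN; case/orP: xab => /eqP->; rewrite lexx ?orbT.
apply/forallP => -[z|]; last by rewrite ltxx andbF.
rewrite -[Some z]/(extension_in z) extension_ltN (leW_mono extension_in_mono).
apply/negP => /andP[/(graded_lt grP) + /orP[]];
  rewrite (le_eqVlt z) => xz;
  by case/predU1P => [/(congr1 rk)|/(graded_lt grP)]; move: rx rab xz; clear; lia.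
Qed.

Lemma extension_coversS x y : covers (extension_in y) (extension_in x) = covers y x.
Proof. exact: ideal_covers extension_in_mono extension_in_closed _ _. Qed.

Lemma extension_coversNl (x : extension a b) : covers x None = false.
Proof. by apply/negP => /covers_lt; case: x => [x|]; rewrite lt_def. Qed.

Lemma extension_minimalS x : minimal (extension_in x) = minimal x.
Proof. exact: ideal_minimal extension_in_mono extension_in_closed _. Qed.

Lemma extension_minimalN : minimal (None : extension a b) = false.
Proof.
apply/negP => /forallP/(_ (extension_in a)).
by rewrite extension_ltN lexx.
Qed.

(** Keeps the bound of [card_vine_le] fixed while the poset grows. *)
Lemma extension_dim : poset_dim (extension a b) = poset_dim P.
Proof.
rewrite /poset_dim -(card_imset _ extension_in_inj); apply: eq_card => -[x|].
  by rewrite -[Some x]/(extension_in x) mem_imset ?inE ?extension_minimalS //;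
     apply: extension_in_inj.
by rewrite inE extension_minimalN; apply/esym/imsetP => -[].
Qed.

Lemma extension_graded : graded extension_rk.
Proof.
case: (grP) => gr0 grlt grc grm; split=> [[x|]|[x|] [y|]|[x|] [y|]|[x|]] //=.
- by rewrite -[Some x]/(extension_in x) -[Some y]/(extension_in y)
    (leW_mono extension_in_mono); apply: grlt.
- rewrite -[Some x]/(extension_in x) extension_ltN => /orP[];
  by rewrite le_eqVlt => /predU1P[->|/grlt]; lia.
- by rewrite [covers _ _]extension_coversS; apply: grc.
- by rewrite [covers _ _]extension_coversN => /orP[] /eqP->; rewrite ?rab.
- by rewrite [minimal _]extension_minimalS; apply: grm.
- by rewrite extension_minimalN.
Qed.

(** As [a] and [b] lie in different components, they have no common upper cover yet, and the new
    edge closes no cycle. *)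
Lemma extension_vine : vine extension_rk.
Proof.
case: (vP) => _ c2 cu _; have grE := extension_graded.
have c2E (v : extension a b) : ~~ minimal v -> #|covered_by v| = 2.
  case: v => [v|_].
    rewrite [minimal _]extension_minimalS => /c2 <-.
    rewrite -(card_imset _ extension_in_inj); apply: eq_card => -[x|].
      by rewrite [RHS]mem_imset ?inE ?[LHS]extension_coversS //;
         apply: extension_in_inj.
    by rewrite inE extension_coversNl; apply/esym/imsetP => -[].
  rewrite -[RHS](_ : #|[set a; b]| = 2); last by rewrite cards2 ab.
  rewrite -(card_imset _ extension_in_inj); apply: eq_card => -[x|].
    by rewrite [RHS]mem_imset ?inE ?[LHS]extension_coversN //;
       apply: extension_in_inj.
  by rewrite inE extension_coversNl; apply/esym/imsetP => -[].
have abN u : covers u a -> covers u b -> False.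
  move=> ua ub; case/negP: nab; apply: connect1.
  by rewrite (vine_adjE vP) eqxx ab; apply/existsP; exists u; rewrite ua.
have cab u x y : x != y -> (x == a) || (x == b) -> (y == a) || (y == b) ->
    covers u x -> covers u y -> False.
  move=> xy /orP[] /eqP xE /orP[] /eqP yE; rewrite xE yE ?eqxx // in xy *.
    exact: abN.
  by move=> ub ua; apply: abN ua ub.
split=> // [[x|] [y|]|i _ s cs].
- have cS z t : covers (Some t : extension a b) (Some z) = covers t z.
    exact: extension_coversS.
  have cN z : covers (None : extension a b) (Some z) = (z == a) || (z == b).
    exact: extension_coversN.
  move=> u v xy rxy; have {}xy : x != y by [].
  have {}rxy : rk x = rk y by [].
  case: u v => [u|] [v|] //; rewrite ?cS ?cN.
  + by move=> ux uy vx vy; rewrite (cu x y u v).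
  + by move=> ux uy xab yab; case: (cab u x y).
  + by move=> xab yab ux uy; case: (cab v x y).
- by move=> u v _ _ _; rewrite extension_coversNl.
- by move=> u v _ _; rewrite extension_coversNl.
- by move=> u v _ _; rewrite extension_coversNl.
have aE := adjE grE c2E i; case/andP: cs => cs us.
(* Nothing covers the new element, so it is isolated in its level graph and no cycle meets it. *)
have [s0 sE] : exists s0, s = map extension_in s0.
  have: all isSome s.
    apply/allP => -[//|] /(next_cycle cs).
    by rewrite aE => /and3P[_ _ /existsP[u]]; rewrite extension_coversNl.
  elim: s {cs us} => [|[x|] s IHs] //=; first by exists [::].
  by case/IHs => t ->; exists (x :: t).
rewrite sE size_map; move: cs us; rewrite sE cycle_map map_inj_uniq;
  last exact: extension_in_inj.
(* The only edge that may be new joins [a] and [b], in the level of [a]. *)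
have adj_sub x y :
    adj (level extension_rk i) (level_edges extension_rk i)
      (extension_in x) (extension_in y) ->
    adj (level rk i) (level_edges rk i) x y \/
      i = rk a /\ add_edge (adj (level rk i) (level_edges rk i)) a b x y.
  rewrite aE => /and3P[rx xy /existsP[[u|]]].
    rewrite !extension_coversS => uxy; left.
    rewrite (vine_adjE vP) [_ == _]rx [_ != _]xy.
    by apply/existsP; exists u.
  rewrite !extension_coversN => /andP[xab yab]; right; split.
    by rewrite -(eqP rx) /=; case/orP: xab => /eqP->.
  move: xy; rewrite (inj_eq extension_in_inj) /add_edge.
  by case/orP: xab => /eqP->; case/orP: yab => /eqP->; rewrite !eqxx ?orbT.
have [ia|ia] := eqVneq i (rk a).
  move=> cs us; apply: (@acyclic_add_edge _ _ a b (@adj_sym _ _ _)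
    (@vine_forest _ _ _ vP (rk a)) nab).
  rewrite /ucycle us andbT; apply: sub_cycle cs => x y /adj_sub.
  by rewrite ia => -[xy|[]//]; rewrite /add_edge xy.
move=> cs us; apply: (@vine_forest _ _ _ vP i); rewrite /ucycle us andbT.
by apply: sub_cycle cs => x y /adj_sub[//|[iE]]; rewrite iE eqxx in ia.
Qed.

(** The only new pair with a common upper cover is [a], [b], for which a common lower cover is
    assumed. *)
Lemma extension_proximity : proximity rk ->
  ((2 <= rk a)%N -> exists c, covers a c /\ covers b c) -> proximity extension_rk.
Proof.
move=> pP cab i x y i2 rx ry xy [v [vx vy]].
case: x rx xy vx => [x|] rx xy vx; last by rewrite extension_coversNl in vx.
case: y ry xy vy => [y|] ry xy vy; last by rewrite extension_coversNl in vy.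
have cS z t : covers (Some t : extension a b) (Some z) = covers t z.
  exact: extension_coversS.
suff [c [xc yc]] : exists c, covers x c /\ covers y c.
  by exists (extension_in c); rewrite !cS.
case: v vx vy => [v|]; first by rewrite !cS => vx vy; apply: (pP i) => //; exists v.
have cN z : covers (None : extension a b) (Some z) = (z == a) || (z == b).
  exact: extension_coversN.
rewrite !cN; have {}xy : x != y by [].
move=> xab yab; have [|c [ac bc]] := cab.
  by move: rx => /=; case/orP: xab => /eqP->; lia.
exists c; case/orP: xab xy => /eqP->; case/orP: yab => /eqP->;
  by rewrite ?eqxx.
Qed.
End AddElement.

(** * The implications between the three conditions *)

Lemma LR_vine_proximity (d : Order.disp_t) (P : finPOrderType d) (rk : P -> nat) :
  LR_vine rk -> proximity rk.
Proof.
case=> vP LR i a b i2 ra rb ab [v [va vb]].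
have [_ _ _ pv] := LR v.
have av := ltW (covers_lt va); have bv := ltW (covers_lt vb).
have cv := ideal_covers (principal_ideal_mono v) principal_ideal_closed.
have [//|//|//||c [ac bc]] := pv i (exist _ a av) (exist _ b bv) i2.
  by exists (exist _ v (lexx v)); rewrite -!cv.
by exists (val c); move: ac bc; rewrite -!cv.
Qed.

Lemma m_vine_proximity (d : Order.disp_t) (P : finPOrderType d) (rk : P -> nat) :
  m_vine rk -> proximity rk.
Proof.
case=> d' [R [rkR [f [[_ _ _ pR] f_mono f_ideal rk_f]]]].
exact: ideal_proximity f_mono f_ideal rk_f pR.
Qed.

Lemma R_vine_m_vine (d : Order.disp_t) (P : finPOrderType d) (rk : P -> nat) :
  R_vine rk -> m_vine rk.
Proof.
move=> RP; exists d, P, rk, id; split=> //.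
by move=> x y _; exists y.
Qed.

(** [P] is an ideal of its extension, and an ideal of an ideal is an ideal. *)
Lemma m_vine_extension (d : Order.disp_t) (P : finPOrderType d) (rk : P -> nat)
  (a b : P) : m_vine (extension_rk rk (a := a) (b := b)) -> m_vine rk.
Proof.
case=> d' [R [rkR [f [RR f_mono f_ideal rk_f]]]].
exists d', R, rkR, (f \o @extension_in _ _ a b); split=> //=.
- by move=> x y; rewrite /= f_mono.
- move=> x y yx; have [z yz] := f_ideal _ _ yx.
  have [|t zt] := @extension_in_closed _ _ a b x z; first by rewrite -f_mono -yz.
  by exists t; rewrite yz zt.
Qed.

(* If all elements of [P_i] sharing a lower cover were connected in [F_i],
   connectedness of [F_(i-1)] would propagate to [F_i], because its edges are
   the elements of [P_i] and adjacent edges share a lower cover. *)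
Lemma disconnected_pair (d : Order.disp_t) (P : finPOrderType d) (rk : P -> nat) i :
    vine rk -> (0 < i)%N ->
    (forall j, (0 < j < i)%N -> {in level rk j &, forall x y,
      connect (adj (level rk j) (level_edges rk j)) x y}) ->
    ~ {in level rk i &, forall x y,
      connect (adj (level rk i) (level_edges rk i)) x y} ->
  exists a b, [/\ rk a = i, rk b = i,
    ~~ connect (adj (level rk i) (level_edges rk i)) a b
    & (2 <= i)%N -> exists c, covers a c /\ covers b c].
Proof.
move=> vP i0 con ncon; have grP : graded rk by case: vP.
set F := adj _ _ in ncon *.
(* In the bottom level no common lower cover is required, so any disconnected pair will do. *)
have [i1|i2] := leqP i 1.
  have : ~~ [forall x in level rk i, [forall y in level rk i, connect F x y]].
    by apply/negP => /forall_inP H; apply: ncon => x y /H/forall_inP; apply.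
  rewrite negb_forall_in => /exists_inP[a]; rewrite inE => /eqP ra.
  rewrite negb_forall_in => /exists_inP[b]; rewrite inE => /eqP rb nab.
  by exists a, b; split=> // i2; rewrite leqNgt ltnS i1 in i2.
pose Q a b c := [&& rk a == i, rk b == i, ~~ connect F a b, covers a c & covers b c].
have [/existsP[a /existsP[b /existsP[c /and5P[/eqP ra /eqP rb nab ac bc]]]]|] :=
  boolP [exists a, [exists b, [exists c, Q a b c]]].
  by exists a, b; split=> // _; exists c.
rewrite negb_exists => /forallP nQ; case: ncon => u v.
have {nQ}share a b c : rk a = i -> covers a c -> covers b c -> connect F a b.
  move=> ra ac bc; have rb : rk b = i.
    by rewrite (graded_covers grP bc) -(graded_covers grP ac).
  have := nQ a; rewrite negb_exists => /forallP/(_ b).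
  rewrite negb_exists => /forallP/(_ c).
  by rewrite /Q ra rb ac bc !eqxx /= !andbT negbK.
rewrite !inE => /eqP ru /eqP rv.
have [|x ux] := @nonminimal_covers _ _ _ grP u; first by lia.
have [|y vy] := @nonminimal_covers _ _ _ grP v; first by lia.
have rx := graded_covers grP ux; have ry := graded_covers grP vy.
have cxy : connect (adj (level rk i.-1) (level_edges rk i.-1)) x y.
  have [ix iy] : rk x = i.-1 /\ rk y = i.-1 by rewrite -{1}ru -rv rx ry.
  by apply: con; rewrite ?inE ?ix ?iy //; move: i2; clear; lia.
(* The path from [x] to [y] one level down is followed: each of its edges is an element of rank [i],
   and consecutive ones share a vertex. *)
suff : forall w, covers w y -> connect F u w by apply.
move: cxy => /(@connect_ind _ _ (fun y => forall w, covers w y -> connect F u w)); apply.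
  move=> s t; rewrite (vine_adjE vP) => /and3P[/eqP rs _ /existsP[e /andP[es et]]].
  move=> IH w wt; apply: connect_trans (IH e es) (share e w t _ et wt).
  by rewrite (graded_covers grP es) rs; lia.
by move=> w wx; apply: share ru ux wx.
Qed.

Lemma proximity_m_vine (d : Order.disp_t) (P : finPOrderType d) (rk : P -> nat) :
  vine rk -> proximity rk -> m_vine rk.
Proof.
(* The measure is the room left under the bound of [card_vine_le]. *)
have [n] := ubnP ((poset_dim P).+1 ^ 2 - #|P|)%N.
elim: n P rk => // n IHn P rk ltn vP pP.
pose con i := [forall x in level rk i, [forall y in level rk i,
  connect (adj (level rk i) (level_edges rk i)) x y]].
have conP i : reflect {in level rk i &, forall x y,
  connect (adj (level rk i) (level_edges rk i)) x y} (con i).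
  apply: (iffP forall_inP) => H x; last by move=> xi; apply/forall_inP => y; apply: H.
  by move=> y xi yi; have /forall_inP := H x xi; apply.
have [allc|] := boolP [forall i : 'I_(poset_rank rk).+1, (0 < i)%N ==> con i].
  apply: R_vine_m_vine; apply: connected_R_vine => // i /andP[i0 ir].
  by apply/conP; have /forallP/(_ (Ordinal (n := (poset_rank rk).+1) ir)) := allc;
     rewrite i0.
rewrite negb_forall => /existsP[i0]; rewrite negb_imply => Pi0.
have exi : exists i, (0 < i)%N && ~~ con i by exists i0.
(* The least disconnected level is taken, so that all levels below it are connected. *)
case: (ex_minnP exi) => i /andP[i_gt0 /conP ncon] mini {exi i0 Pi0}.
have [|a [b [ra rb nab cab]]] := disconnected_pair vP i_gt0 _ ncon.
  move=> j /andP[j0 ji]; apply/conP; apply: contraT => nc.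
  by have := mini j; rewrite j0 nc leqNgt ji => /(_ isT).
rewrite -ra in nab cab.
have rab : rk a = rk b by rewrite rb.
apply: (@m_vine_extension _ _ _ a b); apply: IHn.
- have vE := extension_vine vP rab nab.
  (* Applied to the extension, the bound exceeds the size of [P], so the truncated difference really
     drops. *)
  have := card_vine_le vE; rewrite extension_dim card_option => ltP.
  by rewrite -ltnS subnSK.
- exact: extension_vine.
- exact: extension_proximity.
Qed.

Theorem theorem6p13 (d : Order.disp_t) (P : finPOrderType d) (rk : P -> nat)
    (hP : vine rk) :
  [<-> m_vine rk; proximity rk; LR_vine rk].
Proof.
tfae.
- exact: m_vine_proximity.
- exact: proximity_LR_vine.
(* The way from (3) back to (1) leads through (2). *)
- by move/LR_vine_proximity; apply: proximity_m_vine.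
Qed.
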